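(* Let $(R,\mathfrak m)$ be a Cohen-Macaulay local ring of positive dimension and of prime characteristic $p>0$. Let $M$ be a finitely generated $R$-module which has a rank. Assume $F^n(M)$ is maximal Cohen-Macaulay for some $n\geq \kappa(R)$. Then $M$ is free.
   Context: $f\colon R\to R$, $f(r)=r^p$, is the Frobenius endomorphism; ${}^{f^n}\!R$ denotes $R$ viewed as an $R$-module via $f^n$. The Frobenius functor is $F^n(M)=M\otimes_R {}^{f^n}\!R$, regarded as an $R$-module via the right factor. $q=p^n$; for an ideal $I$, $I^{[q]}$ is the ideal generated by $q$-th powers of generators of $I$. $\kappa(R)=\inf\{t : \text{there is a system of parameters }\mathbf x\text{ of }R\text{ with }\mathfrak m^{[p^t]}\subseteq(\mathbf x)\}$. $M$ has a rank $r$ if $S^{-1}M\cong (S^{-1}R)^r$, where $S$ is the set of nonzerodivisors of $R$. *)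

(* Defs.v *)
From HB Require Import structures.
From mathcomp Require Import all_boot all_order all_algebra.
Set Implicit Arguments. Unset Strict Implicit. Unset Printing Implicit Defensive.
Import Order.TTheory GRing.Theory Num.Theory.
Local Open Scope ring_scope.

Section CommAlg.
Variable R : comUnitRingType.

Definition is_ideal (I : R -> Prop) : Prop :=
  I 0 /\ (forall a b, I a -> I b -> I (a + b)) /\ (forall r a, I a -> I (r * a)).

Definition is_prime_ideal (P : R -> Prop) : Prop :=
  is_ideal P /\ ~ P 1 /\ (forall a b, P (a * b) -> P a \/ P b).

Definition is_max_ideal (I : R -> Prop) : Prop :=
  is_ideal I /\ ~ I 1 /\
  (forall J : R -> Prop, is_ideal J -> (forall a, I a -> J a) ->
     (forall a, J a <-> I a) \/ J 1).

Definition local_with (m : R -> Prop) : Prop :=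
  is_max_ideal m /\ (forall I, is_max_ideal I -> forall a, I a <-> m a).

Definition in_ideal_gen (xs : seq R) (a : R) : Prop :=
  exists rs : seq R, size rs = size xs /\ a = \sum_(i < size xs) rs`_i * xs`_i.

Definition noetherian : Prop :=
  forall I : R -> Prop, is_ideal I ->
    exists xs : seq R, forall a, I a <-> in_ideal_gen xs a.

Definition krull_dim_ge (d : nat) : Prop :=
  exists P : nat -> R -> Prop,
    (forall i, (i <= d)%N -> is_prime_ideal (P i)) /\
    (forall i, (i < d)%N ->
       (forall a, P i a -> P i.+1 a) /\ exists a, P i.+1 a /\ ~ P i a).

Definition krull_dim (d : nat) : Prop := krull_dim_ge d /\ ~ krull_dim_ge d.+1.

Definition is_sop (m : R -> Prop) (d : nat) (xs : seq R) : Prop :=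
  size xs = d /\ (forall x, x \in xs -> m x) /\
  (forall P, is_prime_ideal P -> (forall x, x \in xs -> P x) ->
     forall a, P a <-> m a).

(* n >= kappa(R), kappa(R) = inf { t | exists sop x, m^[p^t] \subseteq (x) }.
   m^[q] is the ideal generated by q-th powers of generators of m; since
   char R = p it is the ideal generated by all a^q, a in m. *)
Definition kappa_le (p : nat) (m : R -> Prop) (d : nat) (n : nat) : Prop :=
  exists t, (t <= n)%N /\ exists xs, is_sop m d xs /\
    forall a, m a -> in_ideal_gen xs (a ^+ (p ^ t)%N).

Section Modules.
Variable M : lmodType R.

Definition in_submod (xs : seq R) (v : M) : Prop :=
  exists vs : seq M, size vs = size xs /\ v = \sum_(i < size xs) xs`_i *: vs`_i.

Definition regular_seq (m : R -> Prop) (xs : seq R) : Prop :=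
  (forall x, x \in xs -> m x) /\
  (forall i, (i < size xs)%N -> forall v,
      in_submod (take i xs) (xs`_i *: v) -> in_submod (take i xs) v) /\
  (exists v, ~ in_submod xs v).

Definition depth_eq (m : R -> Prop) (d : nat) : Prop :=
  (exists xs, size xs = d /\ regular_seq m xs) /\
  ~ (exists xs, size xs = d.+1 /\ regular_seq m xs).

Definition lin_comb (rs : seq R) (ms : seq M) : M :=
  \sum_(i < size ms) rs`_i *: ms`_i.

Definition fin_gen : Prop :=
  exists ms : seq M, forall v, exists rs, size rs = size ms /\ v = lin_comb rs ms.

Definition free_module : Prop :=
  exists ms : seq M,
    (forall v, exists rs, size rs = size ms /\ v = lin_comb rs ms) /\
    (forall rs, size rs = size ms -> lin_comb rs ms = 0 -> forall i, rs`_i = 0).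

Definition nzd (s : R) : Prop := forall b, s * b = 0 -> b = 0.

(* S^{-1} M ~= (S^{-1} R)^r, S = nonzerodivisors, written out elementwise:
   ms is (the image of) an S^{-1}R-basis of S^{-1}M. *)
Definition has_rank (r : nat) : Prop :=
  exists ms : seq M, size ms = r /\
    (forall rs, size rs = r ->
       (exists s, nzd s /\ s *: lin_comb rs ms = 0) -> forall i, rs`_i = 0) /\
    (forall v, exists s, nzd s /\ exists rs, size rs = r /\ s *: v = lin_comb rs ms).

(* balanced maps M x {}^{f^n}R -> W  (q = p^n), W an R-module through the
   right factor *)
Definition frob_balanced (p n : nat) (W : lmodType R) (g : M -> R -> W) : Prop :=
  (forall u v s, g (u + v) s = g u s + g v s) /\
  (forall u s t, g u (s + t) = g u s + g u t) /\
  (forall r u s, g (r *: u) s = g u (r ^+ (p ^ n)%N * s)) /\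
  (forall u r s, g u (r * s) = r *: g u s).

Definition is_linear_map (W W' : lmodType R) (f : W -> W') : Prop :=
  forall a u v, f (a *: u + v) = a *: f u + f v.

Definition frobenius_tensor (p n : nat) (T : lmodType R) (beta : M -> R -> T) : Prop :=
  frob_balanced p n beta /\
  forall (W : lmodType R) (g : M -> R -> W), frob_balanced p n g ->
    (exists f : T -> W, is_linear_map f /\ forall u s, f (beta u s) = g u s) /\
    (forall f1 f2 : T -> W, is_linear_map f1 -> is_linear_map f2 ->
       (forall u s, f1 (beta u s) = f2 (beta u s)) -> forall t, f1 t = f2 t).

End Modules.
End CommAlg.

(* Main.v *)
Require Import Defs.
From HB Require Import structures.
From mathcomp Require Import all_boot all_order all_algebra.
From mathcomp Require Import boolp classical_sets.
Import GRing.Theory.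
Local Open Scope ring_scope.
Set Implicit Arguments.
Unset Strict Implicit.
Unset Printing Implicit Defensive.

(** Let [v_1, ..., v_k] be a minimal generating family of [M], [q = p^n],
    [T = F^n(M)] and [t_i = v_i (x) 1]. A relation among the [v_i] has its
    coefficients in [m], so a relation among the [t_i] has its coefficients in
    [m^[q]], hence in [(x)] for a system of parameters [x]: the kernel [K] of
    [R^k -> T] lies in [x R^k]. A [T]-regular sequence [y] of length [d] in [m]
    satisfies [y_j^q \in (x)], which forces the Koszul homology [H_1(x; T)] to
    vanish (descending induction along [T / (y_1, ..., y_j) T]: multiplication
    by [y_j^q] is null-homotopic on the Koszul complex). Hence [K = x K], and
    [K = 0] by Nakayama's lemma, so [T] is free on the [t_i]. Applying Frobenius
    to the relations that express [s v_j] ([s] a nonzerodivisor) through [rank M]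
    elements shows [k <= rank M], so a determinant argument makes the [v_i]
    independent. *)

(** * Koszul complexes modulo a submodule *)

Record is_submod (R : comUnitRingType) (V : lmodType R) (N : V -> Prop) : Prop :=
  IsSubmod {
    submod0 : N 0;
    submodD : forall u v, N u -> N v -> N (u + v);
    submodZ : forall a u, N u -> N (a *: u) }.

Section SubmodTheory.
Variables (R : comUnitRingType) (V : lmodType R) (N : V -> Prop).
Hypothesis HN : is_submod N.

Lemma submodN u : N u -> N (- u).
Proof. by rewrite -scaleN1r; apply: submodZ. Qed.

Lemma submodB u v : N u -> N v -> N (u - v).
Proof. by move=> Nu /submodN; apply: submodD. Qed.

Lemma submod_sum (I : finType) (F : I -> V) :
  (forall i, N (F i)) -> N (\sum_i F i).
Proof.
by move=> NF; apply: big_ind => //; [exact: submod0 | exact: submodD].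
Qed.

End SubmodTheory.

Section Koszul.
Variables (R : comUnitRingType) (V : lmodType R).
Implicit Types (x r : nat -> R) (N : V -> Prop).

(* The pair [(f0, f1)] stands for [f0 + f1 /\ e_n], so [kos n] is the Koszul
   complex on [n] elements with all degrees collected in one module, [kd x] is
   its differential and [kh r] the exterior product with [\sum_i r i e_i]. *)
Fixpoint kos (n : nat) : lmodType R :=
  if n is n'.+1 then (kos n' * kos n')%type else V.

Fixpoint kd x n : kos n -> kos n :=
  if n is n'.+1 return kos n -> kos n
  then fun f => (kd x f.1 + x n' *: f.2, - kd x f.2) else fun=> 0.

Fixpoint kh r n : kos n -> kos n :=
  if n is n'.+1 return kos n -> kos n
  then fun f => (kh r f.1, r n' *: f.1 - kh r f.2) else fun=> 0.

(** The components of exterior degree below [i] vanish. The second slot carries one extra basis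
    vector, hence [i.-1]; at [i = 0] the truncated predecessor imposes nothing. *)
Fixpoint kdeg_ge (i n : nat) : kos n -> Prop :=
  if n is n'.+1 return kos n -> Prop
  then fun f => kdeg_ge i f.1 /\ kdeg_ge i.-1 f.2
  else fun v => if i is 0 then True else v = 0.

Fixpoint kin N n : kos n -> Prop :=
  if n is n'.+1 return kos n -> Prop
  then fun f => kin N f.1 /\ kin N f.2 else fun v => N v.

Fixpoint kdeg0 (v : V) n : kos n :=
  if n is n'.+1 return kos n then (kdeg0 v n', 0) else v.

(** The degree one element with coefficient [e i] on the basis vector [i < n]. *)
Fixpoint kdeg1 (e : nat -> V) n : kos n :=
  if n is n'.+1 return kos n then (kdeg1 e n', kdeg0 (e n') n') else 0.

Fixpoint kcoef0 n : kos n -> V :=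
  if n is n'.+1 return kos n -> V then fun f => kcoef0 f.1 else id.

Lemma kd_is_linear x n : linear (@kd x n).
Proof.
elim: n => [|n IH] a f g /=; first by rewrite scaler0 addr0.
congr pair; rewrite /= IH; last by rewrite opprD scalerN.
by rewrite !scalerDr !scalerA addrACA mulrC.
Qed.
HB.instance Definition _ x n :=
  GRing.isLinear.Build R (kos n) (kos n) *:%R (@kd x n) (kd_is_linear x (n:=n)).

Lemma kdD x n (f g : kos n) : kd x (f + g) = kd x f + kd x g.
Proof. exact: linearD. Qed.

Lemma kdZ x n a (f : kos n) : kd x (a *: f) = a *: kd x f.
Proof. exact: linearZ. Qed.

Lemma kdB x n (f g : kos n) : kd x (f - g) = kd x f - kd x g.
Proof. exact: linearB. Qed.

Lemma kh_is_linear r n : linear (@kh r n).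
Proof.
elim: n => [|n IH] a f g /=; first by rewrite scaler0 addr0.
congr pair; rewrite /= !IH // !scalerDr !scalerA opprD addrACA scalerN.
by rewrite mulrC.
Qed.
HB.instance Definition _ r n :=
  GRing.isLinear.Build R (kos n) (kos n) *:%R (@kh r n) (kh_is_linear r (n:=n)).

Lemma kdd x n (f : kos n) : kd x (kd x f) = 0.
Proof.
elim: n f => [|n IH] f //=.
congr pair; rewrite ?linearD ?linearN ?linearZ /= ?IH ?oppr0 //.
by rewrite add0r scalerN subrr.
Qed.

(** Homotopy formula: by induction on [n], the mixed terms at the new basis vector cancel, leaving
    the pairing of [r] and [x]. Hence elements of the ideal of the [x i] act null-homotopically. *)
Lemma kdh x r n (f : kos n) :
  kd x (kh r f) + kh r (kd x f) = (\sum_(i < n) r i * x i) *: f.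
Proof.
elim: n f => [|n IH] f /=; first by rewrite big_ord0 scale0r addr0.
case: f => f0 f1; rewrite -/(kos n) in f0 f1 *.
rewrite big_ord_recr /=; congr pair; rewrite /= !scalerDl -!IH.
  rewrite [X in _ + X = _]linearD [X in _ + (_ + X) = _]linearZ /=.
  by rewrite scalerBr scalerA [r n * _]mulrC addrACA subrK.
rewrite [X in - X + _]linearB [X in - (X - _) + _]linearZ /=.
rewrite [kh r (- _)]linearN opprB opprK scalerDr scalerA -!addrA.
by congr (_ + _); rewrite addKr addrC.
Qed.

Lemma kinP N n : is_submod N -> is_submod (@kin N n).
Proof.
move=> HN; elim: n => [|n [IH0 IHD IHZ]] //; split=> //=.
- by move=> f g [f0 f1] [g0 g1]; split; apply: IHD.
- by move=> a f [f0 f1]; split; apply: IHZ.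
Qed.

Lemma kdeg_geP i n : is_submod (@kdeg_ge i n).
Proof.
elim: n i => [|n IH] i; last first.
  have [IH0 IHD IHZ] := IH i; have [JH0 JHD JHZ] := IH i.-1; split=> //=.
  - by move=> f g [f0 f1] [g0 g1]; split; [apply: IHD | apply: JHD].
  - by move=> a f [f0 f1]; split; [apply: IHZ | apply: JHZ].
case: i => [|i] //=; split=> //= [u v -> ->|a u ->]; first exact: addr0.
exact: scaler0.
Qed.

Lemma kin_kd N x n (f : kos n) : is_submod N -> kin N f -> kin N (kd x f).
Proof.
move=> HN; elim: n f => [|n IH] f /=; first by move=> _; exact: submod0.
have HK := kinP n HN; move=> [f0 f1]; split.
  by apply: (submodD HK); [exact: IH | exact: (submodZ HK)].
by apply: (submodN HK); exact: IH.
Qed.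

Lemma kin_kh N r n (f : kos n) : is_submod N -> kin N f -> kin N (kh r f).
Proof.
move=> HN; elim: n f => [|n IH] f /=; first by move=> _; exact: submod0.
have HK := kinP n HN; move=> [f0 f1]; split; first exact: IH.
by apply: (submodB HK); [exact: (submodZ HK) | exact: IH].
Qed.

Lemma kdeg_geW i n (f : kos n) : kdeg_ge i.+1 f -> kdeg_ge i f.
Proof.
elim: n i f => [|n IH] i f /=; first by case: i.
by case: i => [|i] [f0 f1]; split=> //; apply: IH.
Qed.

Lemma kdeg_ge0 n (f : kos n) : kdeg_ge 0 f.
Proof. by elim: n f => [|n IH] f //=. Qed.

Lemma kdeg_ge_gt n (f : kos n) : kdeg_ge n.+1 f -> f = 0.
Proof.
elim: n f => [|n IH] f //= [f0 f1].
case: f f0 f1 => a b /= /kdeg_geW a0 b0.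
by rewrite (IH _ a0) (IH _ b0).
Qed.

Lemma kdeg_ge_kd i x n (f : kos n) : kdeg_ge i.+1 f -> kdeg_ge i (kd x f).
Proof.
elim: n i f => [|n IH] i f /=; first by case: i.
have HK j := kdeg_geP j n; move=> [f0 f1]; split.
  by apply: (submodD (HK i)); [exact: IH | exact: (submodZ (HK i))].
apply: (submodN (HK _)).
by case: i f0 f1 => [|i] _ f1; [exact: kdeg_ge0 | exact: IH].
Qed.

Lemma kdeg_ge_kh i r n (f : kos n) : kdeg_ge i f -> kdeg_ge i.+1 (kh r f).
Proof.
elim: n i f => [|n IH] i f //= [f0 f1].
have HK := kdeg_geP i n; split; first exact: IH.
apply: (submodB HK); first exact: (submodZ HK).
by case: i f0 f1 HK => [|i] /= f0 f1 HK; [exact: kdeg_ge0 | exact: IH].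
Qed.

(** The module [V / N] is represented by [N] alone, so dividing it further by [y] means enlarging
    [N] to [N + y V]. *)
Definition addmul N (y : R) (v : V) : Prop :=
  exists2 u, N u & exists w, v = u + y *: w.

Lemma addmulP N y : is_submod N -> is_submod (addmul N y).
Proof.
move=> HN; split.
- by exists 0; [exact: submod0 | exists 0; rewrite scaler0 addr0].
- move=> _ _ [u Nu [w ->]] [u' Nu' [w' ->]].
  exists (u + u'); first exact: (submodD HN).
  by exists (w + w'); rewrite scalerDr addrACA.
move=> a _ [u Nu [w ->]]; exists (a *: u); first exact: (submodZ HN).
by exists (a *: w); rewrite scalerDr !scalerA mulrC.
Qed.

Lemma kin_addmul N y n (f : kos n) : N 0 -> kin (addmul N y) (y *: f).
Proof.
move=> N0; elim: n f => [|n IH] f //=.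
by exists 0 => //; exists f; rewrite add0r.
Qed.

(** The splitting is made coefficient by coefficient. Coefficients forced to vanish by the degree
    bound are split into zeros, so both parts inherit the bound. *)
Lemma kin_split N (y : R) i n (f : kos n) :
    kdeg_ge i f -> kin (addmul N y) f ->
    N 0 ->
  exists u w, [/\ kin N u, kdeg_ge i u, kdeg_ge i w & f = u + y *: w].
Proof.
move=> fi fN N0; elim: n i f fi fN => [|n IH] i f /=.
  case: i => [_ [u Nu [w ->]]|i -> _]; first by exists u, w.
  by exists 0, 0; rewrite scaler0 addr0.
case: f => f0 f1 /= [/IH H0 /IH H1] [/H0 [u0 [w0 [? ? ? ->]]]].
move=> /H1 [u1 [w1 [? ? ? ->]]].
by exists (u0, u1), (w0, w1).
Qed.

Lemma kin_unscale N N' (y : R) n (f : kos n) :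
  (forall v, N (y *: v) -> N' v) -> kin N (y *: f) -> kin N' f.
Proof.
move=> yN; elim: n f => [|n IH] f /=; first exact: yN.
by case: f => f0 f1 /= [/IH ? /IH ?].
Qed.

Lemma kin_scale N N' (y : R) n (f : kos n) :
  (forall v, N v -> N' (y *: v)) -> kin N f -> kin N' (y *: f).
Proof.
move=> yN; elim: n f => [|n IH] f /=; first exact: yN.
by case: f => f0 f1 /= [/IH ? /IH ?].
Qed.

Lemma kin_sub N N' n (f : kos n) :
  (forall v, N v -> N' v) -> kin N f -> kin N' f.
Proof.
move=> NN'; rewrite -[X in kin N' X]scale1r; apply: kin_scale => v.
by rewrite scale1r; apply: NN'.
Qed.

Lemma kd_kdeg0 x v n : kd x (kdeg0 v n) = 0.
Proof.
elim: n => [|n IH] //=.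
by congr pair; rewrite /= ?IH ?scaler0 ?addr0 // linear0 oppr0.
Qed.

Lemma kdeg1_ge e n : kdeg_ge 1 (kdeg1 e n).
Proof. by elim: n => [|n IH] //=; split=> //; exact: kdeg_ge0. Qed.

Lemma kdeg0_is_linear n : linear (kdeg0^~ n).
Proof.
elim: n => [|n IH] a u v //=.
by congr pair; rewrite /= ?IH // scaler0 addr0.
Qed.

Lemma kcoef0_is_linear n : linear (@kcoef0 n).
Proof. by elim: n => [|n IH] a f g //=; rewrite IH. Qed.

Lemma kd_kdeg1 e x n :
  kd x (kdeg1 e n) = kdeg0 (\sum_(i < n) x i *: e i) n.
Proof.
elim: n => [|n IH] /=; first by rewrite big_ord0.
congr pair; rewrite /= ?kd_kdeg0 ?oppr0 //.
by rewrite IH big_ord_recr /= [in RHS]addrC kdeg0_is_linear addrC.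
Qed.

Lemma kin_kdeg0 N v n : is_submod N -> N v -> kin N (kdeg0 v n).
Proof.
move=> HN Nv; elim: n => [|n IH] //=; split=> //.
exact: (submod0 (kinP n HN)).
Qed.

Lemma kdeg0K v n : kcoef0 (kdeg0 v n) = v.
Proof. by elim: n. Qed.

(** Only the degree one coefficients of [f] reach degree zero under the differential; these are the
    [e i]. *)
Lemma kcoef0_kd N x n (f : kos n) : kin N f -> N 0 ->
  exists2 e : nat -> V, (forall i, N (e i)) &
    kcoef0 (kd x f) = \sum_(i < n) x i *: e i.
Proof.
elim: n f => [|n IH] f /= fN N0; first by exists (fun=> 0); rewrite ?big_ord0.
case: f fN => f0 f1 /= [f0N f1N].
have [e Ne eE] := IH f0 f0N N0.
exists (fun i => if i == n then kcoef0 f1 else e i).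
  move=> i; case: ifP => // _.
  by elim: {IH f0 eE f0N} n f1 f1N => [|n IH] f1 //= [/IH].
rewrite addrC kcoef0_is_linear eE big_ord_recr /= eqxx addrC; congr (_ + _).
by apply: eq_bigr => i _; rewrite (ltn_eqF (ltn_ord i)).
Qed.

(* Exactness in exterior degrees at least [i] of the Koszul complex on
   [x 0, ..., x n.-1] with coefficients in [V / N]. *)
Definition kexact x n i N : Prop :=
  forall f : kos n, kdeg_ge i f -> kin N (kd x f) ->
    exists2 g : kos n, kdeg_ge i.+1 g & kin N (f - kd x g).

(* Filter [V / (N + y^a V)] by the images of the powers of [y]: every factor
   is a copy of [V / (N + y V)]. *)
Lemma kexact_addmulX x n i N y a : is_submod N ->
    (forall v, N (y *: v) -> N v) ->
  kexact x n i (addmul N y) -> kexact x n i (addmul N (y ^+ a)).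
Proof.
move=> HN yN ex; elim: a => [|a IH] f fi df.
  (* For exponent 0 the enlarged submodule is all of [V], so every element is congruent to the
     boundary of 0. *)
  exists 0; first exact: (submod0 (kdeg_geP _ _)).
  by rewrite linear0 subr0 -(scale1r f) expr0; apply: kin_addmul (submod0 HN).
have sN k v : N v -> addmul N k v.
  by exists v => //; exists 0; rewrite scaler0 addr0.
(* Exactness modulo [y] yields [f - kd x g = u + y *: w] with [u] in [N]; the induction hypothesis
   will then be applied to [w]. *)
have [|g gi fg] := ex f fi.
  apply: kin_sub df => _ [u Nu [w ->]]; exists u => //.
  by exists (y ^+ a *: w); rewrite scalerA -exprS.
have fgi : kdeg_ge i (f - kd x g).
  by apply: (submodB (kdeg_geP _ _)) => //; apply: kdeg_ge_kd.
have [u [w [Nu ui wi fgE]]] := kin_split fgi fg (submod0 HN).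
(* Up to [N], [y *: kd x w] equals [kd x f], which lies in [N + y^(a+1) V]; regularity of [y] on
   [V / N] cancels one factor. *)
have dw : kin (addmul N (y ^+ a)) (kd x w).
  apply: (@kin_unscale (addmul N (y ^+ a.+1)) _ y) => [v [u' Nu' [w' vE]]|].
    exists (v - y ^+ a *: w'); last by exists w'; rewrite subrK.
    by apply: yN; rewrite scalerBr scalerA -exprS vE addrK.
  have -> : y *: kd x w = kd x f - kd x u.
    rewrite -[in RHS](subrK (kd x g) f) fgE !kdD kdd addr0.
    by rewrite kdZ addrAC subrr add0r.
  apply: (submodB (kinP _ (addmulP _ HN))) => //.
  by apply: kin_sub (kin_kd x HN Nu); apply: sN.
have [g' gi' wg'] := IH w wi dw.
exists (g + y *: g').
  by apply: (submodD (kdeg_geP _ _)) => //; apply: (submodZ (kdeg_geP _ _)).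
rewrite kdD kdZ opprD addrA fgE -addrA -scalerBr.
apply: (submodD (kinP _ (addmulP _ HN))); first by apply: kin_sub Nu; apply: sN.
apply: (kin_scale _ wg') => _ [v Nv [v' ->]]; exists (y *: v).
  exact: (submodZ HN).
by exists v'; rewrite scalerDr scalerA -exprS.
Qed.

(* Multiplication by [y ^+ a] is null-homotopic, since it is in the ideal of
   the [x i]. *)
Lemma kexact_step x r n i N y a : is_submod N ->
    (forall v, N (y *: v) -> N v) ->
    y ^+ a = \sum_(i < n) r i * x i ->
  kexact x n i.+1 (addmul N y) -> kexact x n i N.
Proof.
move=> HN yN yE /(kexact_addmulX (a := a) HN yN) ex f fi df.
have HK := kinP n HN.
have hdf := kin_kh r HN df.
have dhf := kdh x r f; rewrite -yE in dhf.
have hfi : kdeg_ge i.+1 (kh r f) by exact: kdeg_ge_kh.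
(* By the homotopy formula [kd x (kh r f)] is [y ^+ a *: f] minus a term in [N], so [kh r f] is a
   cycle modulo [N + y^a V]. *)
have [|g gi hfg] := ex _ hfi.
  rewrite -[kd x _](addrK (kh r (kd x f))) dhf addrC.
  rewrite -scaleN1r.
  apply: (submodD (kinP _ (addmulP _ HN))).
    apply: (submodZ (kinP _ (addmulP _ HN))); apply: kin_sub hdf => v Nv.
    by exists v => //; exists 0; rewrite scaler0 addr0.
  exact: kin_addmul (submod0 HN).
have hfgi : kdeg_ge i.+1 (kh r f - kd x g).
  by apply: (submodB (kdeg_geP _ _)) => //; apply: kdeg_ge_kd.
have [u [w [Nu ui wi hfE]]] := kin_split hfgi hfg (submod0 HN).
exists w => //.
have yaN k v : N (y ^+ k *: v) -> N v.
  by elim: k => [|k IH]; rewrite ?expr0 ?scale1r // exprS -scalerA => /yN.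
apply: (@kin_unscale N N (y ^+ a)) => //; first exact: yaN.
(* Since [y ^+ a *: w] is [kh r f] up to a boundary and [u], the homotopy formula leaves only terms
   with coefficients in [N]. *)
have -> : y ^+ a *: (f - kd x w) = kh r (kd x f) + kd x u.
  rewrite scalerBr -dhf -kdZ -[in LHS](subrK (kd x g) (kh r f)).
  rewrite hfE !kdD kdd addr0.
  by rewrite addrAC addrK addrC.
by apply: (submodD HK) => //; apply: kin_kd.
Qed.

Lemma kexact_gt x n N : is_submod N -> kexact x n n.+1 N.
Proof.
move=> HN f /kdeg_ge_gt -> _; exists 0; first exact: (submod0 (kdeg_geP _ _)).
by rewrite linear0 subr0; exact: (submod0 (kinP n HN)).
Qed.

(** Seen in degree one, [e] is a cycle modulo [N], hence a boundary plus an element with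
    coefficients in [N]; the differential kills the boundary. In effect, the part of [x V] inside
    [N] is [x N]. *)
Lemma kexact1_sum x n N (e : nat -> V) : is_submod N -> kexact x n 1 N ->
    N (\sum_(i < n) x i *: e i) ->
  exists2 e' : nat -> V, (forall i, N (e' i)) &
    \sum_(i < n) x i *: e i = \sum_(i < n) x i *: e' i.
Proof.
move=> HN ex Ne.
have [|g _ gN] := ex _ (kdeg1_ge e n).
  by rewrite kd_kdeg1; apply: kin_kdeg0.
have [e' Ne' eE] := kcoef0_kd x gN (submod0 HN).
exists e' => //; rewrite -eE kdB kdd subr0 kd_kdeg1.
by rewrite kdeg0K.
Qed.
End Koszul.

(** * Local and noetherian rings *)

Section LocalRing.
Variables (R : comUnitRingType) (m : R -> Prop).
Hypothesis Hm : local_with m.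

(** Zorn's lemma puts [a] in a maximal ideal, which is [m] by locality. *)
Lemma local_nonunit a : a \isn't a GRing.unit -> m a.
Proof.
(* Membership of [a] is required only of nonempty [J], because the union of the empty chain is empty
   and must satisfy [P]. *)
move=> aU; pose P (J : set R) := [/\ forall u v, J u -> J v -> J (u + v),
  forall r u, J u -> J (r * u), ~ J 1 & forall u, J u -> J a].
have [F FP tot|A [[AD AM A1 Aa] Amax]] := @Zorn_bigcup R P.
  split.
  - move=> u v [X FX Xu] [Y FY Yv].
    have [XY|YX] := tot _ _ FX FY.
      exists Y => //; have [YD _ _ _] := FP _ FY.
      by apply: YD => //; apply: XY.
    exists X => //; have [XD _ _ _] := FP _ FX.
    by apply: XD => //; apply: YX.
  - move=> r u [X FX Xu]; exists X => //.
    by have [_ XM _ _] := FP _ FX; apply: XM.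
  - by move=> [X FX X1]; have [_ _ /(_ X1)] := FP _ FX.
  - move=> u [X FX Xu]; exists X => //.
    by have [_ _ _ Xa] := FP _ FX; apply: Xa Xu.
(* Otherwise [A] is empty, and the principal ideal of [a], proper as [a] is no unit, contradicts
   maximality. *)
have {}Aa : A a.
  apply: contrapT => nAa; apply: (Amax (fun b => exists r, r * a = b)).
    split; last by move=> H; apply/nAa/H; exists 1; rewrite ?mul1r.
    by move=> u /Aa.
  split.
  - by move=> _ _ [r <-] [s <-]; exists (r + s); rewrite ?mulrDl.
  - by move=> r _ [s <-]; exists (r * s); rewrite ?mulrA.
  - move=> [r ra]; case/negP: aU; apply/unitrP; exists r.
    by rewrite ra mulrC ra.
  - by move=> _ _; exists 1; rewrite ?mul1r.
have Aid : is_ideal A by split; [rewrite -(mul0r a); apply: AM | split].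
have Amx : is_max_ideal A.
  split; first exact: Aid.
  split=> // J [J0 [JD JM]] AJ; case: (pselect (J 1)) => [|J1]; first by right.
  left=> b; split=> [Jb|]; last exact: AJ.
  apply: contrapT => nAb; apply: (Amax J); last by split=> // u _; apply: AJ.
  by split=> [u|H]; [exact: AJ | exact/nAb/H].
by case: Hm => _ /(_ A Amx a) [] /(_ Aa).
Qed.

Lemma local_ideal : is_ideal m.
Proof. by case: Hm => [[]]. Qed.

Lemma local_unit1B a : m a -> 1 - a \is a GRing.unit.
Proof.
move=> ma; apply/negPn/negP => /local_nonunit m1a.
case: Hm => [[[_ [mD _]] [m1 _]] _]; apply: m1.
by rewrite -(subrK a 1); apply: mD.
Qed.

Definition generates (M : lmodType R) (N : M -> Prop) k (v : 'I_k -> M) : Prop :=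
  forall u, N u -> exists a : 'I_k -> R, u = \sum_i a i *: v i.

(** Induction on the number of generators: the first is a combination of all of them with
    coefficients in [m]; as [1 - a ord0] is a unit, it can be solved for and eliminated. *)
Lemma nakayama (M : lmodType R) (N : M -> Prop) k (v : 'I_k -> M) :
    (forall i, N (v i)) -> generates N v ->
    (forall u, N u -> exists l (x : 'I_l -> R) (e : 'I_l -> M),
       [/\ forall i, m (x i), forall i, N (e i) & u = \sum_i x i *: e i]) ->
  forall u, N u -> u = 0.
Proof.
have [m0 [mD mM]] := local_ideal.
move=> Nv gen NmN.
have {gen NmN} : forall u, N u ->
    exists2 a : 'I_k -> R, forall i, m (a i) & u = \sum_i a i *: v i.
  move=> u /NmN [l [x [e [mx Ne ->]]]].
  have /fin_all_exists [b eE] : forall i, exists b : 'I_k -> R,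
    e i = \sum_j b j *: v j by move=> i; apply: gen.
  exists (fun j => \sum_i b i j * x i).
    by move=> j; apply: big_ind => // i _; apply: mM.
  under eq_bigr do rewrite eE scaler_sumr; rewrite exchange_big /=.
  apply: eq_bigr => j _; rewrite scaler_suml.
  by apply: eq_bigr => i _; rewrite scalerA mulrC.
elim: k v Nv => [|k IH] v Nv H u Nu.
  by have [a _ ->] := H u Nu; rewrite big_ord0.
apply: (IH (fun i => v (lift ord0 i))) => // {}u {}Nu.
have [b mb ->] := H u Nu; have [a ma v0E] := H _ (Nv ord0).
have Ua := local_unit1B (ma ord0).
exists (fun i => b ord0 * (1 - a ord0)^-1 * a (lift ord0 i) + b (lift ord0 i)).
  by move=> i; apply: mD => //; apply: mM.
have {}v0E : v ord0 = (1 - a ord0)^-1 *: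
    \sum_(i < k) a (lift ord0 i) *: v (lift ord0 i).
  have <- : (1 - a ord0) *: v ord0 =
      \sum_(i < k) a (lift ord0 i) *: v (lift ord0 i).
    rewrite scalerBl scale1r [X in X - _]v0E.
    by rewrite big_ord_recl addrAC subrr add0r.
  by rewrite scalerA mulVr // scale1r.
rewrite big_ord_recl v0E !scaler_sumr -big_split /=; apply: eq_bigr => i _.
by rewrite !scalerA -scalerDl.
Qed.

Lemma minimal_generators (M : lmodType R) k (v : 'I_k -> M) :
    generates (fun=> True) v ->
  exists l (w : 'I_l -> M), generates (fun=> True) w /\
    forall a : 'I_l -> R, \sum_i a i *: w i = 0 -> forall i, m (a i).
Proof.
elim: k v => [|k IH] v gen; first by exists 0, v; split=> // ? _ [].
case: (pselect (forall a : 'I_k.+1 -> R,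
    \sum_i a i *: v i = 0 -> forall i, m (a i))) => [|/existsNP [a]].
  by exists k.+1, v.
move=> /not_implyP [a0 /existsNP [j maj]].
have Uj : a j \is a GRing.unit by apply: contrapT => /negP /local_nonunit.
apply: (IH (fun i => v (lift j i))) => u _.
have [b ->] := gen u I.
(* Subtracting [b j / a j] times the relation removes [v j]. *)
exists (fun i => b (lift j i) - b j * (a j)^-1 * a (lift j i)).
rewrite -[LHS]subr0 -[X in _ - X = _](scaler0 _ (b j * (a j)^-1)).
rewrite -[X in _ - (_ *: X) = _]a0 !(bigD1_ord j) //=.
rewrite scalerDr scalerA divrK // opprD addrACA subrr add0r scaler_sumr -sumrB.
apply: eq_bigr => i _.
by rewrite scalerA -scalerBl.
Qed.

(** The [phi i] are coordinates, jointly injective on [N]. Induction on their number: the values of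
    the first one form a finitely generated ideal; lifts of its generators, with generators of the
    part of [N] where it vanishes, generate [N]. *)
Lemma noetherian_generators (M : lmodType R) (N : M -> Prop) k
    (phi : 'I_k -> M -> R) : noetherian R -> is_submod N ->
    (forall i a, {morph phi i : u w / a *: u + w >-> a * u + w}) ->
    (forall u, N u -> (forall i, phi i u = 0) -> u = 0) ->
  exists l (v : 'I_l -> M), (forall i, N (v i)) /\ generates N v.
Proof.
move=> HR; elim: k N phi => [|k IH] N phi HN phiL phi0.
  exists 0, (fun=> 0); split=> [[]|u Nu] //.
  by exists (fun=> 0); rewrite big_ord0; apply: phi0 => // -[].
pose I a := exists2 u, N u & phi ord0 u = a.
have phi00 : phi ord0 0 = 0.
  have := phiL ord0 1 0 0; rewrite scaler0 addr0 mul1r => /eqP.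
  by rewrite -subr_eq subrr => /eqP.
have HI : is_ideal I.
  split; first by exists 0; [exact: submod0|].
  split=> [_ _ [u Nu <-] [w Nw <-]|a _ [u Nu <-]].
    exists (u + w); first exact: (submodD HN).
    by have := phiL ord0 1 u w; rewrite scale1r mul1r.
  exists (a *: u); first exact: (submodZ HN).
  by have := phiL ord0 a u 0; rewrite phi00 !addr0.
have [xs xsE] := HR I HI.
have /fin_all_exists2 [v Nv vE] : forall i : 'I_(size xs),
    exists2 u, N u & phi ord0 u = xs`_i.
  move=> i; apply/xsE; exists (mkseq (fun j => (j == i)%:R) (size xs)).
  rewrite size_mkseq; split=> //.
  rewrite (bigD1 i) //= big1 ?addr0 ?nth_mkseq ?eqxx ?mul1r // => j ji.
  by rewrite nth_mkseq // (_ : (_ == _) = false) ?mul0r //; apply/negbTE.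
have [|i a|u [Nu u0] ui|l [w [Nw gw]]] :=
    IH (fun u => N u /\ phi ord0 u = 0) (fun i => phi (lift ord0 i)).
- split=> [|u w [Nu u0] [Nw w0]|a u [Nu u0]].
  + by split=> //; exact: submod0.
  + split; first exact: (submodD HN).
    by have := phiL ord0 1 u w; rewrite scale1r mul1r u0 w0 addr0.
  + split; first exact: (submodZ HN).
    by have := phiL ord0 a u 0; rewrite phi00 !addr0 u0 mulr0.
- exact: phiL.
- apply: phi0 => // i.
  by case: (unliftP ord0 i) => [j|] ->; [exact: ui | exact: u0].
exists (size xs + l)%N,
  (fun i => match split i with inl i => v i | inr i => w i end).
split=> [i|u Nu]; first by case: (split i) => [|j] //; case: (Nw j).
have [|rs [_ uE]] := (xsE (phi ord0 u)).1; first by exists u.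
have phi_sum (J : finType) (a : J -> R) (z : J -> M) :
    phi ord0 (\sum_i a i *: z i) = \sum_i a i * phi ord0 (z i).
  by apply: (big_rec2 (fun x y => phi ord0 x = y)) => // i x y _ <-; exact: phiL.
have [|b bE] := gw (u - \sum_(i < size xs) rs`_i *: v i).
  split.
    apply: (submodB HN) => //; apply: submod_sum => // i.
    exact: (submodZ HN).
  have := phiL ord0 (-1) (\sum_(i < size xs) rs`_i *: v i) u.
  rewrite scaleN1r addrC => ->; rewrite phi_sum uE mulN1r addrC.
  by apply/eqP; rewrite subr_eq0; apply/eqP/eq_bigr => i _; rewrite vE.
exists (fun i => match split i with inl i => rs`_i | inr i => b i end).
rewrite big_split_ord /= -[LHS](subrK (\sum_(i < size xs) rs`_i *: v i)).
rewrite bE [LHS]addrC; congr (_ + _); apply: eq_bigr => i _.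
  by have /= -> := unsplitK (inl i : 'I_(size xs) + 'I_l).
by have /= -> := unsplitK (inr i : 'I_(size xs) + 'I_l).
Qed.
End LocalRing.

(** Supplies test modules for the universal property of the tensor product. Membership is made
    boolean classically, and scalars act through representatives. *)
Lemma quotient_module (R : comUnitRingType) (V : lmodType R) (N : V -> Prop) :
  is_submod N -> exists (W : lmodType R) (pi : V -> W),
    (forall a u v, pi (a *: u + v) = a *: pi u + pi v) /\
    (forall u, pi u = 0 <-> N u).
Proof.
move=> HN; pose S : {pred V} := fun v => `[< N v >].
have SE u : u \in S = `[< N u >] by [].
have HS : zmod_closed S.
  split; first by apply/asboolP; exact: submod0.
  by move=> u v /asboolP Nu /asboolP Nv; apply/asboolP; exact: (submodB HN).
pose S' : zmodClosed V := HB.pack S (GRing.isZmodClosed.Build V S HS).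
pose W := Quotient.quot S'.
pose pi (v : V) : W := \pi_W%qT v.
have piE u v : (pi u == pi v) = (u - v \in S).
  by rewrite -(Quotient.idealrBE S').
have piK w : pi (repr w) = w by exact: reprK.
have piD u v : pi (u + v) = pi u + pi v by rewrite /pi raddfD.
pose sc (a : R) (w : W) : W := pi (a *: repr w).
have piZ a v : pi (a *: v) = sc a (pi v).
  apply/eqP; rewrite piE SE -scalerBr; apply/asboolP/(submodZ HN).
  by apply/asboolP; rewrite -SE -piE piK.
have sc1 : left_id 1 sc by move=> w; rewrite /sc scale1r piK.
have scA a b w : sc a (sc b w) = sc (a * b) w.
  by rewrite -(piK w) -!piZ scalerA.
have scDr : right_distributive sc +%R.
  by move=> a w w'; rewrite -(piK w) -(piK w') -piD -!piZ -piD scalerDr.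
have scDl w : {morph sc^~ w : a b / a + b}.
  by move=> a b; rewrite -(piK w) -!piZ -piD scalerDl.
pose W' : lmodType R :=
  HB.pack W (GRing.Zmodule_isLmodule.Build R W scA sc1 scDr scDl).
exists W', pi; split=> [a u v|u]; first by rewrite piD piZ.
rewrite (_ : 0 = pi 0); last by rewrite /pi raddf0.
split=> [/eqP|Nu]; first by rewrite piE subr0 SE => /asboolP.
by apply/eqP; rewrite piE subr0 SE; apply/asboolP.
Qed.

(** * Frobenius base change *)

Section LinearMaps.
Variables (R : comUnitRingType) (V W : lmodType R) (f : V -> W).
Hypothesis fL : is_linear_map f.

Lemma is_linear_map0 : f 0 = 0.
Proof.
have := fL 1 0 0; rewrite scaler0 addr0 scale1r => /eqP.
by rewrite -subr_eq subrr => /eqP.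
Qed.

Lemma is_linear_mapD u v : f (u + v) = f u + f v.
Proof. by have := fL 1 u v; rewrite !scale1r. Qed.

Lemma is_linear_mapZ a u : f (a *: u) = a *: f u.
Proof. by have := fL a u 0; rewrite is_linear_map0 !addr0. Qed.

Lemma is_linear_mapB u v : f (u - v) = f u - f v.
Proof. by rewrite -scaleN1r is_linear_mapD is_linear_mapZ scaleN1r. Qed.

Lemma is_linear_map_sum (I : finType) (a : I -> R) (v : I -> V) :
  f (\sum_i a i *: v i) = \sum_i a i *: f (v i).
Proof.
apply: (big_rec2 (fun x y => f x = y)) => [|i x y _ <-]; last exact: fL.
exact: is_linear_map0.
Qed.
End LinearMaps.

Section Frobenius.
Variables (R : comUnitRingType) (p n : nat) (M : lmodType R).
Hypothesis pR : p \in [pchar R].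
Let q := (p ^ n)%N.

Lemma frobD (a b : R) : (a + b) ^+ q = a ^+ q + b ^+ q.
Proof.
apply: exprDn_pchar; rewrite /q pnatX pnatE ?pR //.
by case/andP: pR.
Qed.

Lemma frobB (a b : R) : (a - b) ^+ q = a ^+ q - b ^+ q.
Proof. by rewrite -[in RHS](subrK b a) [in RHS]frobD addrK. Qed.

Lemma frob_balanced_sum (W : lmodType R) (g : M -> R -> W) k (a : 'I_k -> R)
    (v : 'I_k -> M) s : frob_balanced p n g ->
  g (\sum_i a i *: v i) s = \sum_i (a i ^+ q * s) *: g (v i) 1.
Proof.
move=> [gD [_ [gZ gM]]].
have g0 : g 0 s = 0.
  have := gD 0 0 s; rewrite addr0 => /eqP.
  by rewrite -subr_eq subrr => /eqP.
apply: (big_rec2 (fun x y => g x s = y)) => [//|i x y _ <-].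
by rewrite gD gZ -[in LHS](mulr1 (_ * s)) gM.
Qed.

Variables (T : lmodType R) (beta : M -> R -> T).
Hypothesis HT : frobenius_tensor p n beta.

(** The projection of [T] modulo the span of these elements and the zero map agree on pure tensors,
    so they are equal by uniqueness. *)
Lemma frobenius_generates k (v : 'I_k -> M) : generates (fun=> True) v ->
  generates (fun=> True) (fun i => beta (v i) 1).
Proof.
move=> gen; case: HT => bal univ.
pose N t := exists a : 'I_k -> R, t = \sum_i a i *: beta (v i) 1.
have HN : is_submod N.
  split; first by exists (fun=> 0); rewrite big1 // => i _; rewrite scale0r.
  - move=> _ _ [a ->] [b ->]; exists (fun i => a i + b i).
    by rewrite -big_split; apply: eq_bigr => i _; rewrite scalerDl.
  - move=> c _ [a ->]; exists (fun i => c * a i).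
    by rewrite scaler_sumr; apply: eq_bigr => i _; rewrite scalerA.
have [W [pi [piL piE]]] := quotient_module HN.
move=> t _; suff /piE [a ->] : pi t = 0 by exists a.
have [|_ uniq] := univ W (fun _ _ => 0).
  by split; [|split; [|split]] => *; rewrite ?addr0 ?scaler0.
apply: (uniq pi (fun=> 0)) => // [a u w|u s]; first by rewrite scaler0 addr0.
apply/piE; have [a ->] := gen u I.
by exists (fun i => a i ^+ q * s); rewrite frob_balanced_sum.
Qed.

(** Sending [(u, s)] to the class of [a_j^q s] in [R / I], with [a_j] the [j]-th coefficient of [u],
    is well defined: two choices of [a_j] differ by an element of [m], whose [q]-th power lies in
    [I]. The induced map on [T] extracts the class of [c j] from the relation. *)
Lemma frobenius_relation (m I : R -> Prop) k (v : 'I_k -> M) (c : 'I_k -> R) :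
    generates (fun=> True) v ->
    (forall a : 'I_k -> R, \sum_i a i *: v i = 0 -> forall i, m (a i)) ->
    is_ideal I -> (forall a, m a -> I (a ^+ q)) ->
    \sum_i c i *: beta (v i) 1 = 0 ->
  forall i, I (c i).
Proof.
move=> gen rel [I0 [ID IM]] mI c0 j; case: HT => bal univ.
have HI : @is_submod R R^o I by split=> // a u; apply: IM.
have [W [pi [piL piE]]] := quotient_module HI.
have piP (x y : R^o) : I (x - y) -> pi x = pi y.
  by move=> /piE; rewrite (is_linear_mapB piL) => /eqP; rewrite subr_eq0 => /eqP.
have /boolp.choice [co coE] : forall u, exists a : 'I_k -> R,
    u = \sum_i a i *: v i by move=> u; apply: gen.
have coP u (a : 'I_k -> R) s : u = \sum_i a i *: v i ->
    pi (co u j ^+ q * s : R^o) = pi (a j ^+ q * s : R^o).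
  move=> uE; apply: piP; rewrite -mulrBl mulrC; apply: IM; rewrite -frobB.
  apply/mI/(rel (fun i => co u i - a i)).
  under eq_bigr do rewrite scalerBl.
  by rewrite sumrB -coE -uE subrr.
pose g u s := pi (co u j ^+ q * s : R^o).
have g_bal : frob_balanced p n g.
  split; [|split; [|split]]; rewrite /g.
  - move=> u w s; rewrite (coP _ (fun i => co u i + co w i)).
      by rewrite frobD mulrDl (is_linear_mapD piL).
    by under eq_bigr do rewrite scalerDl; rewrite big_split -!coE.
  - by move=> u s t; rewrite mulrDr (is_linear_mapD piL).
  - move=> r u s; rewrite (coP _ (fun i => r * co u i)).
      by rewrite exprMn mulrA [_ * r ^+ _]mulrC.
    by under eq_bigr do rewrite -scalerA; rewrite -scaler_sumr -coE.
  - by move=> u r s; rewrite -(is_linear_mapZ piL) /= mulrCA.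
have [[f [fL fE]] _] := univ W g g_bal.
apply/piE; rewrite -(is_linear_map0 fL) -c0 (is_linear_map_sum fL).
(* The Kronecker symbol is kept under a [q]-th power to match the value of [f] at [beta (v i) 1]. *)
have -> : (c j : R^o) = \sum_i c i *: ((i == j)%:R ^+ q * 1 : R^o).
  rewrite (bigD1 j) //= eqxx expr1n mulr1 big1 ?addr0; first exact/esym/mulr1.
  move=> i /negbTE ->; rewrite expr0n mulr1 expn_eq0.
  case/andP: pR => /prime_gt0; case: (p) => // p' _ _.
  by rewrite scaler0.
rewrite (is_linear_map_sum piL); apply: eq_bigr => i _; congr (_ *: _).
rewrite fE /g (coP _ (fun l => (i == l)%:R)) //.
rewrite (bigD1 i) //= eqxx scale1r big1 ?addr0 // => l.
by rewrite eq_sym => /negbTE ->; rewrite scale0r.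
Qed.
End Frobenius.

(** * Rank *)

(** Padding [A] with zero columns and [B] with zero rows makes both square without changing the
    product; the padded [A] has determinant 0. *)
Lemma det_mulmx_ltn (R : comNzRingType) k r (A : 'M[R]_(k, r)) (B : 'M_(r, k)) :
  (r < k)%N -> \det (A *m B) = 0.
Proof.
move=> rk; have [e ke] : exists e, k = (r + e.+1)%N.
  by exists (k - r.+1)%N; rewrite addnS -addSn subnKC.
move: A B; rewrite {}ke {rk} => A B.
rewrite -[A *m B]addr0 -(mul0mx _ (0 : 'M_(e.+1, _))) -mul_row_col det_mulmx.
rewrite (expand_det_col _ (rshift r ord0)) big1 ?mul0r // => i _.
by rewrite row_mxEr mxE mul0r.
Qed.

Definition independent (R : comUnitRingType) (M : lmodType R) k (v : 'I_k -> M) :=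
  forall a : 'I_k -> R, \sum_i a i *: v i = 0 -> forall i, a i = 0.

Section Rank.
Variables (R : comUnitRingType) (M : lmodType R).

Lemma nzdX (s : R) k : nzd s -> nzd (s ^+ k).
Proof.
move=> sN; elim: k => [|k IH] b; first by rewrite mul1r.
by rewrite exprS -mulrA => /sN /IH.
Qed.

Lemma nzdM (s t : R) : nzd s -> nzd t -> nzd (s * t).
Proof. by move=> sN tN b; rewrite -mulrA => /sN /tN. Qed.

Lemma transition_mul k r (v : 'I_k -> M) (b : 'I_r -> M) s s'
    (A : 'M[R]_(k, r)) (B : 'M[R]_(r, k)) : independent v ->
    (forall j, s *: v j = \sum_i A j i *: b i) ->
    (forall i, s' *: b i = \sum_j B i j *: v j) ->
  A *m B = (s' * s)%:M.
Proof.
move=> vI vE bE; apply/matrixP => j l; rewrite !mxE; apply/eqP.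
rewrite -subr_eq0; apply/eqP.
apply: (vI (fun l => \sum_i A j i * B i l - (s' * s) *+ (j == l))).
under eq_bigr do rewrite scalerBl.
rewrite sumrB [X in _ - X](bigD1 j) //= [X in _ - (_ + X)]big1 ?addr0.
  rewrite eqxx -scalerA vE scaler_sumr; apply/eqP; rewrite subr_eq0; apply/eqP.
  under eq_bigr do rewrite scaler_suml.
  rewrite exchange_big; apply: eq_bigr => i _ /=.
  rewrite scalerA mulrC -scalerA bE scaler_sumr.
  by apply: eq_bigr => l' _; rewrite scalerA.
by move=> l'; rewrite eq_sym => /negbTE ->; rewrite scale0r.
Qed.

(** For [r < k] the determinant of [A *m B] would vanish, yet it is [(s' * s) ^+ k], a
    nonzerodivisor. *)
Lemma independent_leq k r (v : 'I_k -> M) (b : 'I_r -> M) s s'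
    (A : 'M[R]_(k, r)) (B : 'M[R]_(r, k)) : independent v -> nzd s -> nzd s' ->
    (forall j, s *: v j = \sum_i A j i *: b i) ->
    (forall i, s' *: b i = \sum_j B i j *: v j) ->
  (k <= r)%N.
Proof.
move=> vI sN s'N vE bE; rewrite leqNgt; apply/negP => /(det_mulmx_ltn A B).
rewrite (transition_mul vI vE bE) det_scalar.
move=> /(congr1 (fun x => x * 1)); rewrite mul0r => /(nzdX (nzdM s'N sN)).
by move/eqP; rewrite oner_eq0.
Qed.
End Rank.

(** * Maximal Cohen-Macaulay Frobenius base change *)

Section RegularSequence.
Variables (R : comUnitRingType) (V T : lmodType R) (pi : V -> T).
Hypotheses (piL : is_linear_map pi) (pi_surj : forall t, exists v, pi v = t).

Lemma in_submod_takeP (ys : seq R) j (t : T) : (j <= size ys)%N ->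
  in_submod (take j ys) t <->
  exists e : nat -> T, t = \sum_(i < j) ys`_i *: e i.
Proof.
move=> jy; have st : size (take j ys) = j by rewrite size_takel.
split=> [[vs [_ tE]]|[e tE]].
  exists (nth 0 vs); rewrite tE st; apply: eq_bigr => i _.
  by rewrite nth_take.
exists (mkseq e j); rewrite size_mkseq st; split=> //.
by rewrite tE; apply: eq_bigr => i _; rewrite nth_take // nth_mkseq.
Qed.

(** The preimage under [pi] of the submodule of [T] generated by the multiples of the first [j]
    elements of [ys]. *)
Fixpoint ker_add (ys : seq R) j : V -> Prop :=
  if j is j'.+1 then addmul (ker_add ys j') ys`_j' else fun v => pi v = 0.

Lemma ker_add_submod ys j : is_submod (ker_add ys j).
Proof.
elim: j => [|j IH]; last exact: addmulP.
split=> /= [|u v u0 v0|a u u0]; first exact: is_linear_map0.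
  by rewrite (is_linear_mapD piL) u0 v0 addr0.
by rewrite (is_linear_mapZ piL) u0 scaler0.
Qed.

Lemma ker_addP ys j v : ker_add ys j v <->
  exists e : nat -> T, pi v = \sum_(i < j) ys`_i *: e i.
Proof.
elim: j v => [|j IH] v /=.
  by split=> [->|[e ->]]; [exists (fun=> 0)|]; rewrite big_ord0.
split=> [[u /IH [e uE] [w ->]]|[e vE]].
  exists (fun i => if i == j then pi w else e i).
  rewrite (is_linear_mapD piL) (is_linear_mapZ piL) uE big_ord_recr /= eqxx.
  by congr (_ + _); apply: eq_bigr => i _; rewrite (ltn_eqF (ltn_ord i)).
have [w wE] := pi_surj (e j).
exists (v - ys`_j *: w); last by exists w; rewrite subrK.
apply/IH; exists e; rewrite (is_linear_mapB piL) (is_linear_mapZ piL) vE wE.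
by rewrite big_ord_recr /= addrK.
Qed.

Lemma regular_kexact (m : R -> Prop) (xs ys : seq R) q :
    regular_seq T m ys -> size xs = size ys ->
    (forall y, y \in ys -> in_ideal_gen xs (y ^+ q)) ->
  kexact (nth 0 xs) (size xs) 1 (fun v => pi v = 0).
Proof.
move=> [_ [reg _]] xy yq.
(* Descending induction on [j], with [e] counting the elements not yet divided out: modulo the first
   [j] of them, exactness holds in degrees above [j]. At [j = size ys] no degree is left. *)
suff H e j : (j + e = size ys)%N ->
    kexact (nth 0 xs) (size xs) j.+1 (ker_add ys j) by exact: (H (size ys) 0%N).
elim: e j => [|e IH] j je.
  by rewrite -(addn0 j) je xy; apply/kexact_gt/ker_add_submod.
have jy : (j < size ys)%N by rewrite -je addnS ltnS leq_addr.
have [rs [_ rsE]] := yq _ (mem_nth 0 jy).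
apply: (kexact_step (ker_add_submod ys j) _ rsE); last first.
  by apply: (IH j.+1); rewrite addSnnS.
move=> v /ker_addP yvN; apply/ker_addP/(in_submod_takeP _ (ltnW jy)).
apply: reg => //; apply/(in_submod_takeP _ (ltnW jy)).
by rewrite -(is_linear_mapZ piL).
Qed.
End RegularSequence.

Lemma minimal_free_of_regular (R : comUnitRingType) (m : R -> Prop)
    (T : lmodType R) k (t : 'I_k -> T) (xs ys : seq R) q :
    noetherian R -> local_with m -> generates (fun=> True) t ->
    (forall x, x \in xs -> m x) ->
    (forall c : 'I_k -> R, \sum_i c i *: t i = 0 ->
       forall i, in_ideal_gen xs (c i)) ->
    regular_seq T m ys -> size xs = size ys ->
    (forall y, y \in ys -> in_ideal_gen xs (y ^+ q)) ->
  independent t.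
Proof.
move=> HR Hm gen mx rel reg xy yq.
pose pi (c : 'rV[R]_k) := \sum_i c 0 i *: t i.
have piL : is_linear_map pi.
  move=> a u v; rewrite /pi scaler_sumr -big_split; apply: eq_bigr => i _ /=.
  by rewrite !mxE scalerDl scalerA.
have pi_surj u : exists c, pi c = u.
  have [a ->] := gen u I; exists (\row_i a i).
  by apply: eq_bigr => i _; rewrite mxE.
have ex := regular_kexact piL pi_surj reg xy yq.
have HK : is_submod (fun c => pi c = 0) := ker_add_submod piL [::] 0.
have [l [v [Kv gv]]] : exists l (v : 'I_l -> 'rV[R]_k),
    (forall i, pi (v i) = 0) /\ generates (fun c => pi c = 0) v.
  apply: (@noetherian_generators _ _ (fun c => pi c = 0) k (fun i c => c 0 i)) => //.
    by move=> i a u w /=; rewrite !mxE.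
  by move=> u _ u0; apply/rowP => i; rewrite u0 mxE.
have K0 : forall c, pi c = 0 -> c = 0.
  apply: (nakayama Hm Kv gv) => c Kc.
  have /fin_all_exists2 [r _ rE] : forall i, exists2 rs : seq R,
      size rs = size xs & c 0 i = \sum_(j < size xs) rs`_j * xs`_j.
    by move=> i; have [rs []] := rel (fun i => c 0 i) Kc i; exists rs.
  (* The entries of [c] lie in the ideal of [xs]; collecting the coefficients of each generator into
     a row puts [c] in [x R^k]. *)
  have cE : c = \sum_(j < size xs) xs`_j *: (\row_i (r i)`_j).
    apply/rowP => i; rewrite rE summxE; apply: eq_bigr => j _.
    by rewrite !mxE mulrC.
  (* Vanishing of [H_1] replaces these rows by rows in the kernel, as Nakayama's lemma requires. *)
  have [|e Ke eE] := kexact1_sum (e := fun j => \row_i (r i)`_j) HK ex.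
    by rewrite -cE.
  exists (size xs), (fun i => xs`_i), (fun i => e i); split=> [i|i|].
  - exact/mx/mem_nth.
  - exact: Ke.
  - by rewrite {1}cE eE.
move=> a a0 i; have /rowP /(_ i) : \row_i a i = 0 :> 'rV[R]_k.
  by apply: K0; rewrite -[RHS]a0; apply: eq_bigr => j _; rewrite mxE.
by rewrite !mxE.
Qed.

(** * Indexed families, common denominators and the final rank comparison *)

Lemma in_ideal_gen_ideal (R : comUnitRingType) (xs : seq R) :
  is_ideal (in_ideal_gen xs).
Proof.
split.
  exists (nseq (size xs) 0); rewrite size_nseq big1 // => i _.
  by rewrite nth_nseq if_same mul0r.
split=> [_ _ [r [_ ->]] [s [_ ->]]|a _ [r [_ ->]]].
  exists (mkseq (fun i => r`_i + s`_i) (size xs)); rewrite size_mkseq; split=> //.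
  by rewrite -big_split; apply: eq_bigr => i _; rewrite nth_mkseq // mulrDl.
exists (mkseq (fun i => a * r`_i) (size xs)); rewrite size_mkseq; split=> //.
by rewrite mulr_sumr; apply: eq_bigr => i _; rewrite nth_mkseq // mulrA.
Qed.

Lemma lin_comb_mktuple (R : comUnitRingType) (M : lmodType R) k (v : 'I_k -> M)
  (rs : seq R) : lin_comb rs [tuple v i | i < k] = \sum_(i < k) rs`_i *: v i.
Proof.
rewrite /lin_comb -(big_mkord xpredT (fun i => rs`_i *: [tuple v i | i < k]`_i)).
rewrite size_tuple big_mkord; apply: eq_bigr => i _.
by rewrite nth_mktuple.
Qed.

Lemma has_rankP (R : comUnitRingType) (M : lmodType R) r : has_rank M r ->
  exists2 b : 'I_r -> M, independent b &
    forall u, exists2 s, nzd s & exists a : 'I_r -> R, s *: u = \sum_i a i *: b i.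
Proof.
move=> [ms [<- [ind gen]]]; exists (fun i => ms`_i).
  move=> a a0 i; pose rs := [tuple a i | i < size ms].
  rewrite -[LHS](nth_mktuple a 0); apply: (ind rs); first by rewrite size_tuple.
  exists 1; split; first by move=> b; rewrite mul1r.
  rewrite scale1r -[RHS]a0; apply: eq_bigr => j _.
  by rewrite nth_mktuple.
move=> u; have [s [sN [rs [_ uE]]]] := gen u; exists s => //.
by exists (fun i => rs`_i).
Qed.

Lemma common_denominator (R : comUnitRingType) (M : lmodType R) k r
    (v : 'I_k -> M) (b : 'I_r -> M) :
    (forall u, exists2 s, nzd s & exists a : 'I_r -> R,
       s *: u = \sum_i a i *: b i) ->
  exists2 s, nzd s & exists A : 'M[R]_(k, r),
    forall j, s *: v j = \sum_i A j i *: b i.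
Proof.
move=> gen; have /fin_all_exists2 [s sN] : forall j, exists2 s, nzd s &
    exists a : 'I_r -> R, s *: v j = \sum_i a i *: b i by move=> j; apply: gen.
move=> /fin_all_exists [a aE]; exists (\prod_j s j).
  by apply: big_ind => // [x|x y]; [rewrite mul1r | exact: nzdM].
(* Row [j] absorbs the denominators of the other rows. *)
exists (\matrix_(j, i) (\prod_(l | l != j) s l * a j i)) => j.
rewrite (bigD1 j) //= mulrC -scalerA aE scaler_sumr.
by apply: eq_bigr => i _; rewrite mxE scalerA.
Qed.

Lemma generates_matrix (R : comUnitRingType) (M : lmodType R) k r
    (v : 'I_k -> M) (b : 'I_r -> M) : generates (fun=> True) v ->
  exists B : 'M[R]_(r, k), forall i, b i = \sum_j B i j *: v j.
Proof.
move=> gen; have /fin_all_exists [a aE] : forall i, exists a : 'I_k -> R,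
  b i = \sum_j a j *: v j by move=> i; apply: gen.
exists (\matrix_(i, j) a i j) => i; rewrite {1}aE.
by apply: eq_bigr => j _; rewrite mxE.
Qed.

(** From [B *m A = s%:M], [\det A] divides a power of [s] and is a nonzerodivisor. A relation [c]
    among the [v i] satisfies [c A = 0], and the adjugate turns this into [\det A * c i = 0]. *)
Lemma independent_of_rank (R : comUnitRingType) (M : lmodType R) r
    (v b : 'I_r -> M) s (A : 'M[R]_r) : generates (fun=> True) v ->
    independent b -> nzd s -> (forall j, s *: v j = \sum_i A j i *: b i) ->
  independent v.
Proof.
move=> gen bI sN vE; have [B bE] := generates_matrix b gen.
have BA : B *m A = (s * 1)%:M.
  by apply: (transition_mul bI) vE => i; rewrite scale1r.
move=> c c0; pose cr : 'rV[R]_r := \row_i c i.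
have cA : cr *m A = 0.
  apply/rowP => i; rewrite !mxE; under eq_bigr do rewrite mxE.
  apply: (bI (fun i => \sum_j c j * A j i)).
  under eq_bigr do rewrite scaler_suml.
  rewrite exchange_big -[RHS](scaler0 _ s) -[X in _ = _ *: X]c0 scaler_sumr.
  apply: eq_bigr => j _ /=; rewrite scalerA mulrC -scalerA vE scaler_sumr.
  by apply: eq_bigr => i' _; rewrite scalerA.
have dA : nzd (\det A).
  move=> x /(congr1 ( *%R (\det B))); rewrite mulr0 mulrA -det_mulmx BA.
  by rewrite det_scalar mulr1; apply: nzdX.
have : cr *m A *m \adj A = 0 by rewrite cA mul0mx.
rewrite -mulmxA mul_mx_adj mul_mx_scalar => /rowP cr0 i.
by have := cr0 i; rewrite !mxE => /dA.
Qed.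

Theorem theorem2p4 (R : comUnitRingType) (p : nat) (m : R -> Prop) (d : nat)
    (M : lmodType R) (n : nat) (T : lmodType R) (beta : M -> R -> T) :
  p \in [pchar R] ->
  noetherian R -> local_with m -> krull_dim R d -> (0 < d)%N ->
  @depth_eq R R^o m d ->
  fin_gen M -> (exists r, has_rank M r) ->
  frobenius_tensor p n beta -> kappa_le p m d n ->
  @depth_eq R T m d ->
  free_module M.
Proof.
move=> pR HR Hm _ _ _ [ms msgen] [r rkM] HT [e [en [xs [[xsd [mx _]] mxs]]]].
move=> [[ys [ysd reg]] _].
have xsI := in_ideal_gen_ideal xs.
have mq a : m a -> in_ideal_gen xs (a ^+ (p ^ n)).
  (* As [e <= n], the power [a ^+ (p ^ n)] is a positive power of [a ^+ (p ^ e)], which already lies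
     in the ideal of [xs]. *)
  rewrite -(subnK en) expnD mulnC exprM => /mxs.
  have : (0 < p ^ (n - e))%N.
    by rewrite expn_gt0; case/andP: pR => /prime_gt0 ->.
  by case: (p ^ _)%N => // l _ H; rewrite exprSr; case: xsI => _ [_]; apply.
have msgen' : generates (fun=> True) (fun i : 'I_(size ms) => ms`_i).
  by move=> u _; have [rs [_ uE]] := msgen u; exists (fun i => rs`_i).
have [k [v [gen rel]]] := minimal_generators Hm msgen'.
pose t i := beta (v i) 1.
have tgen : generates (fun=> True) t := frobenius_generates HT gen.
have tI : independent t.
  apply: (minimal_free_of_regular HR Hm tgen mx _ reg) => [c||y ys_y].
  - exact: (frobenius_relation pR HT gen rel xsI mq).
  - by rewrite xsd ysd.
  - by apply: mq; case: reg => my _; apply: my.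
have [b bI bgen] := has_rankP rkM.
have [s sN [A vE]] := common_denominator v bgen.
have [B bE] := generates_matrix b gen.
have nzd1 : nzd (1 : R) by move=> x; rewrite mul1r.
have rk : (r <= k)%N.
  by apply: (independent_leq bI nzd1 sN _ vE (A := B)) => i; rewrite scale1r.
have [B' bE'] := generates_matrix (fun i => beta (b i) 1) tgen.
have kr : (k <= r)%N.
  (* Tensoring the relations for [s *: v j] gives [s ^+ q *: t j] as a combination of the
     [beta (b i) 1] whose coefficients are the [q]-th powers of the entries of [A]. *)
  apply: (independent_leq (b := fun i => beta (b i) 1) (B := B')
    (A := map_mx (fun x => x ^+ (p ^ n)) A) tI (nzdX (k := p ^ n) sN) nzd1) => [j|i].
  2: by rewrite scale1r; apply: bE'.
  case: HT => bal _; have := frob_balanced_sum (fun i => A j i) b 1 bal.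
  rewrite -vE; case: bal => _ [_ [bZ bM]].
  rewrite bZ bM => ->; apply: eq_bigr => i _; by rewrite mxE mulr1.
have {rk}kr : k = r by apply/eqP; rewrite eqn_leq kr rk.
subst r; have vI := independent_of_rank gen bI sN vE.
exists [tuple v i | i < k]; split=> [u|rs]; rewrite size_tuple.
  have [a uE] := gen u I; exists [tuple a i | i < k].
  rewrite size_tuple lin_comb_mktuple; split=> //.
  by rewrite uE; apply: eq_bigr => i _; rewrite nth_mktuple.
move=> srs; rewrite lin_comb_mktuple => /(vI (fun i => rs`_i)) rs0 i.
(* Indices from [k] on read the default value 0. *)
have [ik|ki] := ltnP i k; first exact: (rs0 (Ordinal ik)).
by rewrite nth_default // srs.
Qed.
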